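(* Let $N\ge1$ and let $A(t)$ be a continuous $d\times d$ complex matrix-valued function of $t\in I=[-1,1]$. For $s=1,\dots,d$ let $\mathbf{y}_s$ be the solution on $I$ of $$\dot{\mathbf{y}}_s(t)=A(t)\mathbf{y}_s(t),\qquad\mathbf{y}_s(-1)=\mathbf{e}_s,$$ where $\{\mathbf{e}_s\}$ is the standard basis of $\mathbb{C}^d$. Suppose that $\|\mathbf{y}_s-\mathbf{p}_s\|_\infty\le\nu_s$ for $s=1,\dots,d$, where $\mathbf{p}_s$ is the degree-$N$ collocation approximation of $\mathbf{y}_s$. Let $\Phi_A(t)=[\mathbf{y}_1(t)|\cdots|\mathbf{y}_d(t)]$, the fundamental solution of $\dot{\mathbf{y}}=A(t)\mathbf{y}$, and let $\Phi_N(t)=[\mathbf{p}_1(t)|\cdots|\mathbf{p}_d(t)]$. If $\xi=\left(\sum_{s=1}^d\nu_s^2\right)^{1/2}$ then $|\Phi_A(t)-\Phi_N(t)|\le\xi$ for all $t\in I$. If, furthermore, $\Psi_A(t)$ is the fundamental solution of the adjoint equation $\dot{\mathbf{z}}=-A(t)^\top\mathbf{z}$ (with $\Psi_A(-1)=I_d$), $\Psi_N(t)$ is the collocation approximation of $\Psi_A(t)$, and $|\Psi_A(t)-\Psi_N(t)|\le\omega$ for $t\in I$, then $$\left|\Phi_A(t)\Phi_A(s)^{-1}\right|\le\left(\xi+\|\Phi_N\|_\infty\right)\left(\omega+\|\Psi_N\|_\infty\right)$$ for all $s,t\in I$.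
   Context: $|\cdot|$ is the Euclidean norm on $\mathbb{C}^d$ and the induced norm on $d\times d$ matrices; for continuous vector- or matrix-valued $F$ on $I$, $\|F\|_\infty=\max_{t\in I}|F(t)|$. With $t_j=\cos(\pi j/N)$, $j=0,\dots,N$, the collocation approximation of the solution of $\dot{\mathbf{y}}=M(t)\mathbf{y}$, $\mathbf{y}(-1)=\mathbf{y}_0$, is the $\mathbb{C}^d$-valued polynomial $\mathbf{p}$ of degree at most $N$ with $\dot{\mathbf{p}}(t_j)=M(t_j)\mathbf{p}(t_j)$ for $0\le j\le N-1$ and $\mathbf{p}(-1)=\mathbf{y}_0$ (assumed to exist); for a matrix-valued solution it is taken column by column. *)

(* Defs.v *)
From HB Require Import structures.
From mathcomp Require Export all_boot all_order all_algebra.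
From mathcomp Require Export all_classical all_reals all_analysis.
From mathcomp Require Export complex.

Set Implicit Arguments.
Unset Strict Implicit.
Unset Printing Implicit Defensive.

Import Order.TTheory GRing.Theory Num.Theory.
Import numFieldNormedType.Exports.

Local Open Scope classical_set_scope.
Local Open Scope ring_scope.
Local Open Scope complex_scope.

(* R[i] carries no canonical topology in the libraries: give it the one induced
   by the modulus, as for any numFieldType; matrices over R[i] inherit the
   entrywise topology. *)
HB.instance Definition _ (R : realType) := NormedModule.copy R[i] (R[i])^o.

Section Definitions.
Variable R : realType.

Definition vnorm n (v : 'cV[R[i]]_n) : R :=
  Num.sqrt (\sum_i Normc.normc (v i 0) ^+ 2).

Definition opnorm n (M : 'M[R[i]]_n) : R :=
  sup [set vnorm (M *m v) | v in [set v : 'cV[R[i]]_n | vnorm v <= 1]].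

(* [supI (fun t => vnorm (F t))] and [supI (fun t => opnorm (F t))] are the
   sup-norms of F on [-1, 1]; for continuous F the supremum is a maximum. *)
Definition supI (g : R -> R) : R := sup [set g t | t in `[-1, 1]].

(* The difference quotient is restricted to [-1, 1], so the derivative is
   one-sided at the endpoints. *)
Definition has_derivI m n (F : R -> 'M[R[i]]_(m, n)) (t : R)
    (L : 'M[R[i]]_(m, n)) : Prop :=
  ((u - t)^-1)%:C *: (F u - F t) @[u --> within `[-1, 1] t^'] --> L.

(* k = 1 is the vector equation; k = d with Y0 = 1%:M gives the fundamental
   solution. *)
Definition is_solution d k (M : R -> 'M[R[i]]_d) (Y0 : 'M[R[i]]_(d, k))
    (Y : R -> 'M[R[i]]_(d, k)) : Prop :=
  Y (-1) = Y0 /\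
  forall t : R, t \in `[-1, 1] -> has_derivI Y t (M t *m Y t).

(* A vector- or matrix-valued polynomial is a matrix of polynomials, evaluated
   entrywise at real points. *)
Definition evalmx m n (P : 'M[{poly R[i]}]_(m, n)) (t : R) : 'M[R[i]]_(m, n) :=
  map_mx (fun q : {poly R[i]} => q.[t%:C]) P.

Definition node (N j : nat) : R := cos (pi * j%:R / N%:R).

Definition is_collocation (N d : nat) (M : R -> 'M[R[i]]_d) (y0 : 'cV[R[i]]_d)
    (p : 'cV[{poly R[i]}]_d) : Prop :=
  [/\ forall i, (size (p i ord0) <= N.+1)%N,
      evalmx p (-1) = y0 &
      forall j, (j < N)%N ->
        evalmx (map_mx (@deriv _) p) (node N j) =
          M (node N j) *m evalmx p (node N j)].

Definition is_collocation_mx (N d k : nat) (M : R -> 'M[R[i]]_d)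
    (Y0 : 'M[R[i]]_(d, k)) (P : 'M[{poly R[i]}]_(d, k)) : Prop :=
  forall s, is_collocation N M (col s Y0) (col s P).

(* [v_1 | ... | v_k] *)
Definition of_cols (T : Type) d k (v : 'I_k -> 'cV[T]_d) : 'M[T]_(d, k) :=
  \matrix_(i, s) v s i 0.

End Definitions.

(* Main.v *)
Require Import Defs.
From mathcomp Require Import ring lra.
Import Order.TTheory GRing.Theory Num.Theory.
Import numFieldNormedType.Exports.
Local Open Scope classical_set_scope.
Local Open Scope ring_scope.
Local Open Scope complex_scope.

(** The error matrix Phi_A(t) - Phi_N(t) has columns y_s(t) - p_s(t), of length
    at most nu_s. By Cauchy-Schwarz the induced norm of a matrix is at most its
    Frobenius norm, that is, the square root of the sum of the squared lengths
    of its columns ([opnorm_le_cols]); this gives the bound by xi.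

    For the second bound, the entries of Psi_A^T Phi_A have derivative
    (- A^T Psi_A)^T Phi_A + Psi_A^T A Phi_A = 0, so this product keeps its
    initial value, the identity ([adjoint_solution_inverse]). Hence
    Phi_A(s)^-1 = Psi_A(s)^T, and since transposition preserves the induced norm
    ([opnorm_tr]), |Phi_A(t) Phi_A(s)^-1| <= |Phi_A(t)| |Psi_A(s)|. The triangle
    inequality then compares each factor with its polynomial approximation.

    A supremum in the reals bounds a set only if that set is bounded above, so
    each sup-norm comes with a boundedness proof: a solution is bounded on
    [-1, 1] because it is continuous there, a polynomial because its monomials
    are at most 1 in modulus.

    Derivatives and limits are treated one complex entry at a time, a matrix
    limit being projected to the limits of its entries. *)

Local Notation normc := Normc.normc.

(** * Euclidean norm and induced matrix norm *)

Section EuclideanNorm.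
Set Implicit Arguments.
Unset Strict Implicit.
Variable R : realType.
Implicit Types (n : nat) (z : R[i]).

Lemma normc_ge0 z : 0 <= normc z.
Proof. by case: z => a b; apply: sqrtr_ge0. Qed.

Lemma normcJ z : normc z^* = normc z.
Proof. by case: z => a b /=; rewrite sqrrN. Qed.

Lemma normcB z1 z2 : normc (z1 - z2) = normc (z2 - z1).
Proof.
by case: z1 z2 => [a b] [c d] /=; rewrite -(opprB c a) -(opprB d b) !sqrrN.
Qed.

Lemma normcD z1 z2 : normc (z1 + z2) <= normc z1 + normc z2.
Proof. exact: (@le_normcD R). Qed.

Lemma normc_sum (I : Type) (r : seq I) (F : I -> R[i]) :
  normc (\sum_(i <- r) F i) <= \sum_(i <- r) normc (F i).
Proof.
elim: r => [|i r IH]; first by rewrite !big_nil Normc.normc0.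
by rewrite !big_cons; apply: le_trans (normcD _ _) _; rewrite lerD2l.
Qed.

Lemma normc_real (x : R) : normc x%:C = `|x|.
Proof. by rewrite /= expr0n addr0 sqrtr_sqr. Qed.

(** The modulus in the norm of R[i] is a complex number with zero imaginary part;
    this ties it to the real-valued modulus. *)
Lemma normC_normc z : `|z| = (normc z)%:C.
Proof. by case: z. Qed.

Lemma sqr_normc z : (normc z ^+ 2)%:C = z * z^*.
Proof.
case: z => a b; rewrite /= sqr_sqrtr ?addr_ge0 ?sqr_ge0 //.
by apply/eqP; rewrite eq_complex /=; apply/andP; split; apply/eqP; ring.
Qed.

(** Summing (be a_i - al b_i)^2 >= 0, where al and be are the two square roots,
    gives the inequality multiplied by 2 al be. *)
Lemma Cauchy_Schwarz n (a b : 'I_n -> R) :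
  \sum_i a i * b i <=
  Num.sqrt (\sum_i a i ^+ 2) * Num.sqrt (\sum_i b i ^+ 2).
Proof.
set Sa := \sum_i a i ^+ 2; set Sb := \sum_i b i ^+ 2.
have Sa0 : 0 <= Sa by apply: sumr_ge0 => i _; apply: sqr_ge0.
have Sb0 : 0 <= Sb by apply: sumr_ge0 => i _; apply: sqr_ge0.
have null (c : 'I_n -> R) : \sum_i c i ^+ 2 = 0 -> forall i, c i = 0.
  move=> c0 i; apply/eqP; rewrite -sqrf_eq0; apply/eqP.
  by apply: (psumr_eq0P _ c0) => // j _; apply: sqr_ge0.
have [Sa_eq0|Sa_neq0] := eqVneq Sa 0.
  by rewrite Sa_eq0 sqrtr0 mul0r big1 // => i _; rewrite (null _ Sa_eq0) mul0r.
have [Sb_eq0|Sb_neq0] := eqVneq Sb 0.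
  by rewrite Sb_eq0 sqrtr0 mulr0 big1 // => i _; rewrite (null _ Sb_eq0) mulr0.
set al := Num.sqrt Sa; set be := Num.sqrt Sb.
have al0 : 0 < al by rewrite sqrtr_gt0 lt_def Sa_neq0.
have be0 : 0 < be by rewrite sqrtr_gt0 lt_def Sb_neq0.
have alE : al ^+ 2 = Sa by rewrite sqr_sqrtr.
have beE : be ^+ 2 = Sb by rewrite sqr_sqrtr.
have two : 2 * (al * be) * \sum_i a i * b i <= 2 * (al * be) * (al * be).
  have -> : 2 * (al * be) * (al * be) = be ^+ 2 * Sa + al ^+ 2 * Sb.
    by rewrite -alE -beE; ring.
  rewrite !mulr_sumr -big_split; apply: ler_sum => i _ /=.
  rewrite -subr_ge0.
  have -> : be ^+ 2 * a i ^+ 2 + al ^+ 2 * b i ^+ 2 -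
    2 * (al * be) * (a i * b i) = (be * a i - al * b i) ^+ 2 by ring.
  exact: sqr_ge0.
by rewrite ler_pM2l in two => //; rewrite !mulr_gt0.
Qed.

Lemma vnorm_ge0 n (v : 'cV[R[i]]_n) : 0 <= vnorm v.
Proof. exact: sqrtr_ge0. Qed.

Lemma sqr_vnorm n (v : 'cV[R[i]]_n) :
  vnorm v ^+ 2 = \sum_i normc (v i 0) ^+ 2.
Proof. by rewrite sqr_sqrtr // sumr_ge0 // => i _; apply: sqr_ge0. Qed.

Lemma vnorm_le n (v : 'cV[R[i]]_n) (c : R) : 0 <= c ->
  \sum_i normc (v i 0) ^+ 2 <= c ^+ 2 -> vnorm v <= c.
Proof. by move=> c0; rewrite -sqr_vnorm ler_pXn2r // nnegrE vnorm_ge0. Qed.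

Lemma vnorm0 n : vnorm (0 : 'cV[R[i]]_n) = 0.
Proof.
by rewrite /vnorm big1 ?sqrtr0 // => i _; rewrite mxE Normc.normc0 expr0n.
Qed.

Lemma vnorm0_eq0 n (v : 'cV[R[i]]_n) : vnorm v = 0 -> v = 0.
Proof.
move=> v0; apply/matrixP => i j; rewrite ord1 mxE.
apply: Normc.eq0_normc; apply/eqP; rewrite -sqrf_eq0; apply/eqP.
have := sqr_vnorm v; rewrite v0 expr0n /= => /esym h.
by apply: (psumr_eq0P _ h) => // k _; apply: sqr_ge0.
Qed.

Lemma vnormZ n (c : R[i]) (v : 'cV[R[i]]_n) : vnorm (c *: v) = normc c * vnorm v.
Proof.
rewrite /vnorm -[normc c](ger0_norm (normc_ge0 c)) -sqrtr_sqr -sqrtrM ?sqr_ge0 //.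
rewrite mulr_sumr; congr Num.sqrt; apply: eq_bigr => i _.
by rewrite mxE Normc.normcM exprMn.
Qed.

Lemma vnormJ n (v : 'cV[R[i]]_n) : vnorm (map_mx (fun z => z^*) v) = vnorm v.
Proof.
by rewrite /vnorm; congr Num.sqrt; apply: eq_bigr => i _; rewrite mxE normcJ.
Qed.

Lemma vnorm_le_sum n (v : 'cV[R[i]]_n) : vnorm v <= \sum_i normc (v i 0).
Proof.
have s0 : 0 <= \sum_i normc (v i 0) by apply: sumr_ge0 => i _; apply: normc_ge0.
apply: vnorm_le => //; rewrite [leRHS]expr2 mulr_suml.
apply: ler_sum => i _; rewrite expr2 ler_wpM2l ?normc_ge0 //.
by rewrite (bigD1 i) //= lerDl sumr_ge0 // => j _; apply: normc_ge0.
Qed.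

Lemma normc_dot_le n (v w : 'cV[R[i]]_n) :
  normc (\sum_i v i 0 * w i 0) <= vnorm v * vnorm w.
Proof.
apply: le_trans (normc_sum _ _) _.
under eq_bigr do rewrite Normc.normcM.
exact: Cauchy_Schwarz.
Qed.

Lemma vnormD n (v w : 'cV[R[i]]_n) : vnorm (v + w) <= vnorm v + vnorm w.
Proof.
apply: vnorm_le; first by rewrite addr_ge0 ?vnorm_ge0.
rewrite sqrrD !sqr_vnorm.
apply: (@le_trans _ _ (\sum_i (normc (v i 0) + normc (w i 0)) ^+ 2)).
  apply: ler_sum => i _; rewrite mxE ler_pXn2r ?nnegrE ?addr_ge0 ?normc_ge0 //.
  exact: normcD.
under eq_bigr do rewrite sqrrD.
rewrite !big_split /= lerD2r lerD2l.
by apply: lerD; apply: Cauchy_Schwarz.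
Qed.

(** Row by row, Cauchy-Schwarz bounds the operator norm by the Frobenius norm. *)
Lemma vnorm_mulmx_le m n (M : 'M[R[i]]_(m, n)) (v : 'cV[R[i]]_n) :
  vnorm (M *m v) <= Num.sqrt (\sum_s vnorm (col s M) ^+ 2) * vnorm v.
Proof.
have F0 : 0 <= \sum_s vnorm (col s M) ^+ 2 by apply: sumr_ge0 => s _; apply: sqr_ge0.
apply: vnorm_le; first by rewrite mulr_ge0 ?sqrtr_ge0.
rewrite exprMn sqr_sqrtr //; under [X in X * _]eq_bigr do rewrite sqr_vnorm.
rewrite exchange_big /= mulr_suml; apply: ler_sum => i _.
have -> : (M *m v) i 0 = \sum_j (row i M)^T j 0 * v j 0.
  by rewrite mxE; apply: eq_bigr => j _; rewrite !mxE.
rewrite [X in _ <= X * _](_ : _ = vnorm (row i M)^T ^+ 2); last first.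
  by rewrite sqr_vnorm; apply: eq_bigr => j _; rewrite !mxE.
rewrite -exprMn ler_pXn2r ?nnegrE ?mulr_ge0 ?normc_ge0 ?vnorm_ge0 //.
exact: normc_dot_le.
Qed.

Lemma opnorm_has_ubound n (M : 'M[R[i]]_n) :
  has_ubound [set vnorm (M *m v) | v in [set v : 'cV[R[i]]_n | vnorm v <= 1]].
Proof.
exists (Num.sqrt (\sum_s vnorm (col s M) ^+ 2)) => _ [v /= v1 <-].
apply: le_trans (vnorm_mulmx_le M v) _.
by rewrite ler_piMr ?sqrtr_ge0.
Qed.

Lemma vnorm_mulmx n (M : 'M[R[i]]_n) (v : 'cV[R[i]]_n) :
  vnorm (M *m v) <= opnorm M * vnorm v.
Proof.
have [v0|v_neq0] := eqVneq (vnorm v) 0.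
  by rewrite v0 (vnorm0_eq0 v0) mulmx0 vnorm0 mulr0.
have v_gt0 : 0 < vnorm v by rewrite lt_def v_neq0 vnorm_ge0.
have nv : normc ((vnorm v)^-1)%:C = (vnorm v)^-1.
  by rewrite normc_real ger0_norm // invr_ge0 vnorm_ge0.
rewrite -ler_pdivrMr //.
apply: (ub_le_sup (opnorm_has_ubound M)).
exists (((vnorm v)^-1)%:C *: v) => /=.
  by rewrite vnormZ nv mulVf.
by rewrite -scalemxAr vnormZ nv mulrC.
Qed.

Lemma opnorm_le n (M : 'M[R[i]]_n) (c : R) : 0 <= c ->
  (forall v, vnorm (M *m v) <= c * vnorm v) -> opnorm M <= c.
Proof.
move=> c0 hM; apply: ge_sup.
  by exists (vnorm (M *m 0)), 0 => //=; rewrite vnorm0.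
move=> _ [v /= v1 <-]; apply: le_trans (hM v) _.
by rewrite ler_piMr.
Qed.

Lemma opnorm_ge0 n (M : 'M[R[i]]_n) : 0 <= opnorm M.
Proof.
apply: le_trans (vnorm_ge0 (M *m 0)) _.
by apply: (ub_le_sup (opnorm_has_ubound M)); exists 0 => //=; rewrite vnorm0.
Qed.

Lemma opnorm_le_cols n (M : 'M[R[i]]_n) :
  opnorm M <= Num.sqrt (\sum_s vnorm (col s M) ^+ 2).
Proof. by apply: opnorm_le; [apply: sqrtr_ge0|apply: vnorm_mulmx_le]. Qed.

Lemma opnormD n (M M' : 'M[R[i]]_n) : opnorm (M + M') <= opnorm M + opnorm M'.
Proof.
apply: opnorm_le => [|v]; first by rewrite addr_ge0 ?opnorm_ge0.
rewrite mulmxDl mulrDl; apply: le_trans (vnormD _ _) _.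
by apply: lerD; apply: vnorm_mulmx.
Qed.

Lemma opnormM n (M M' : 'M[R[i]]_n) : opnorm (M *m M') <= opnorm M * opnorm M'.
Proof.
apply: opnorm_le => [|v]; first by rewrite mulr_ge0 ?opnorm_ge0.
rewrite -mulmxA -mulrA; apply: le_trans (vnorm_mulmx _ _) _.
by rewrite ler_wpM2l ?opnorm_ge0 ?vnorm_mulmx.
Qed.

(** With w = M^T v, one has |w|^2 = conj(w)^T M^T v = v^T (M conj(w)), which
    Cauchy-Schwarz bounds by |v| |M| |w|; then divide by |w|. *)
Lemma opnorm_tr_le n (M : 'M[R[i]]_n) : opnorm M^T <= opnorm M.
Proof.
apply: opnorm_le => [|v]; first exact: opnorm_ge0.
set w := M^T *m v; pose w' := map_mx (fun z : R[i] => z^*) w.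
have [->|w_neq0] := eqVneq (vnorm w) 0.
  by rewrite mulr_ge0 ?opnorm_ge0 ?vnorm_ge0.
have w_gt0 : 0 < vnorm w by rewrite lt_def w_neq0 vnorm_ge0.
have ww : (vnorm w ^+ 2)%:C = \sum_i v i 0 * (M *m w') i 0.
  transitivity ((v^T *m (M *m w')) 0 0).
    2: by rewrite mxE; apply: eq_bigr => i _; rewrite mxE.
  rewrite mulmxA -[v^T *m M]trmxK trmx_mul trmxK -/w.
  rewrite sqr_vnorm rmorph_sum mxE; apply: eq_bigr => i _.
  by rewrite /= sqr_normc !mxE.
rewrite -(ler_pM2l w_gt0) -expr2.
have -> : vnorm w ^+ 2 = normc (vnorm w ^+ 2)%:C.
  by rewrite normc_real ger0_norm // sqr_ge0.
rewrite ww; apply: le_trans (normc_dot_le _ _) _.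
rewrite [leRHS](_ : _ = vnorm v * (opnorm M * vnorm w)); last by ring.
by rewrite ler_wpM2l ?vnorm_ge0 // -(vnormJ w) vnorm_mulmx.
Qed.

Lemma opnorm_tr n (M : 'M[R[i]]_n) : opnorm M^T = opnorm M.
Proof.
apply/eqP; rewrite eq_le opnorm_tr_le /=.
by rewrite -[in leLHS](trmxK M) opnorm_tr_le.
Qed.

(** The upper bound c only certifies that the supremum is meaningful: on an
    unbounded set [sup] is a default value. *)
Lemma le_supI (g : R -> R) (c t : R) :
  (forall u, u \in `[-1, 1] -> g u <= c) -> t \in `[-1, 1] -> g t <= supI g.
Proof.
move=> gc t11; apply: ub_le_sup; last by exists t.
by exists c => _ [u /= u11 <-]; apply: gc.
Qed.

End EuclideanNorm.

(** * One-sided calculus for complex-valued functions on [-1, 1] *)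

Section Calculus.
Set Implicit Arguments.
Unset Strict Implicit.
Variable R : realType.
Implicit Types (f g : R -> R[i]) (t : R).

Definition entry_derivI f t (l : R[i]) : Prop :=
  ((u - t)^-1)%:C * (f u - f t) @[u --> within `[-1, 1] t^'] --> l.

Lemma has_derivI_entry m n (F : R -> 'M[R[i]]_(m, n)) t L :
  has_derivI F t L -> forall i j, entry_derivI (fun u => F u i j) t (L i j).
Proof.
move=> dF i j; rewrite /entry_derivI.
have -> : (fun u => ((u - t)^-1)%:C * (F u i j - F t i j)) =
  (fun M : 'M[R[i]]_(m, n) => M i j) \o (fun u => ((u - t)^-1)%:C *: (F u - F t)).
  by apply/funext => u /=; rewrite !mxE.
exact: (cvg_comp _ _ dF (@coord_continuous _ _ _ i j L)).
Qed.

(** Convergence in R[i] quantifies over a positive complex epsilon, which is real;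
    real tolerances are easier to combine with the order of R. *)
Lemma cvg_entryP (T : Type) (F : set_system T) (FF : Filter F) (f : T -> R[i]) l :
  f x @[x --> F] --> l <-> 
  forall e : R, 0 < e -> \forall x \near F, normc (l - f x) < e.
Proof.
split=> [/cvgrPdist_lt h e e0|h].
  have e0' : 0 < e%:C by rewrite ltcR.
  by have := h _ e0'; apply: filterS => x; rewrite normC_normc ltcR.
apply/cvgrPdist_lt => -[e e'] /=; rewrite ltcE /= => /andP[/eqP -> e0].
by have := h _ e0; apply: filterS => x; rewrite -[_ +i* _]/(e%:C) normC_normc ltcR.
Qed.

Lemma punctured_filter t : Filter (within `[-1, 1] t^').
Proof. exact: within_filter. Qed.

(** The increment is (u - t) times the difference quotient, and the first factor
    tends to 0. *)
Lemma entry_derivI_cvg f t l : entry_derivI f t l ->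
  f u @[u --> within `[-1, 1] t^'] --> f t.
Proof.
move=> df.
have u_t : (u - t)%:C @[u --> within `[-1, 1] t^'] --> (0 : R[i]).
  apply/cvg_entryP => e e0; rewrite near_withinE /dnbhs near_withinE.
  near=> u => _ _; rewrite sub0r -rmorphN normc_real opprB.
  near: u; exact: cvgr_dist_lt.
apply/cvg_entryP => e e0.
have /cvg_entryP/(_ e e0) h := cvgD (FF := punctured_filter t)
  (cvgM (FF := punctured_filter t) u_t df) (cvg_cst (FF := punctured_filter t) (f t)).
have u_neq_t : \forall u \near within `[-1, 1] t^', u != t.
  by rewrite near_withinE /dnbhs near_withinE; near=> u.
apply: filterS2 u_neq_t h => u ut.
rewrite /= mul0r add0r; congr (normc (_ - _) < e).
transitivity ((u - t)%:C * (((u - t)^-1)%:C * (f u - f t)) + f t) => //.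
by rewrite mulrA -rmorphM /= mulfV ?subr_eq0 // mul1r subrK.
Unshelve. all: by end_near.
Qed.

Lemma entry_derivID f g t lf lg : entry_derivI f t lf -> entry_derivI g t lg ->
  entry_derivI (fun u => f u + g u) t (lf + lg).
Proof.
move=> df dg; rewrite /entry_derivI.
under eq_fun do rewrite opprD addrACA mulrDr.
exact: cvgD df dg.
Qed.

Lemma entry_derivIM f g t lf lg : entry_derivI f t lf -> entry_derivI g t lg ->
  entry_derivI (fun u => f u * g u) t (lf * g t + f t * lg).
Proof.
move=> df dg; rewrite /entry_derivI.
have -> : (fun u => ((u - t)^-1)%:C * (f u * g u - f t * g t)) =
    (fun u => ((u - t)^-1)%:C * (f u - f t) * g u +
              f t * (((u - t)^-1)%:C * (g u - g t))).
  by apply/funext => u; ring.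
apply: cvgD; first exact: cvgM df (entry_derivI_cvg dg).
by apply: cvgM dg; apply: cvg_cst.
Qed.

Lemma entry_derivI_sum (I : Type) (r : seq I) (F : I -> R -> R[i]) t
    (L : I -> R[i]) :
  (forall k, entry_derivI (F k) t (L k)) ->
  entry_derivI (fun u => \sum_(k <- r) F k u) t (\sum_(k <- r) L k).
Proof.
move=> dF; elim: r => [|k r IH].
  rewrite big_nil /entry_derivI.
  under eq_fun do rewrite !big_nil subrr mulr0.
  exact: cvg_cst.
have -> : (fun u => \sum_(j <- k :: r) F j u) =
    (fun u => F k u + \sum_(j <- r) F j u) by apply/funext => u; rewrite big_cons.
have -> : \sum_(j <- k :: r) L j = L k + \sum_(j <- r) L j by rewrite big_cons.
exact: (entry_derivID (dF k) IH).
Qed.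

(** Used with a 1-Lipschitz phi to reach real-valued functions, for which the
    extreme value theorem and the mean value theorem are stated: phi is the
    modulus for boundedness, the real or imaginary part for constancy. *)
Lemma within_continuous_lipschitz f (phi : R[i] -> R) :
  (forall z w, `|phi z - phi w| <= normc (z - w)) ->
  (forall t, t \in `[-1, 1] -> exists l, entry_derivI f t l) ->
  {within `[-1, 1], continuous (phi \o f)}.
Proof.
move=> phi1 df; apply/subspace_continuousP => t t11.
have [l /entry_derivI_cvg/cvg_entryP ft] := df t t11.
apply/cvgrPdist_lt => e e0.
have := ft e e0; rewrite !near_withinE.
apply: filterS => u; have [-> _ _|ut h u11] := eqVneq u t.
  by rewrite subrr normr0.
by apply: le_lt_trans (phi1 _ _) _; apply: h.
Qed.

Lemma entry_bounded f :
  (forall t, t \in `[-1, 1] -> exists l, entry_derivI f t l) ->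
  exists c, forall t, t \in `[-1, 1] -> normc (f t) <= c.
Proof.
move=> df.
have lip z w : `|normc z - normc w| <= normc (z - w) :> R.
  have := normcD (z - w) w; have := normcD (w - z) z.
  by rewrite !subrK (normcB w) ler_norml => ? ?; lra.
have [] := @EVT_max R (fun u => normc (f u)) (-1) 1 _ (within_continuous_lipschitz lip df).
  by lra.
by move=> c _ hc; exists (normc (f c)) => t; apply: hc.
Qed.

(** In the open interval the restriction to [-1, 1] disappears near t, and a real
    linear phi commutes with difference quotients. *)
Lemma is_derive_linear f (phi : R[i] -> R) t l :
  (forall z w, phi (z - w) = phi z - phi w) ->
  (forall (x : R) z, phi (x%:C * z) = x * phi z) ->
  (forall z, `|phi z| <= normc z) ->
  t \in `]-1, 1[ -> entry_derivI f t l -> is_derive t (1 : R) (phi \o f) (phi l).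
Proof.
move=> phiB phiZ phi1 t11 /cvg_entryP df.
suff h : h^-1 *: ((phi \o f \o shift t) (h *: (1 : R)) - (phi \o f) t)
    @[h --> 0^'] --> phi l.
  by split; [apply/cvg_ex; exists (phi l)|apply: cvg_lim].
apply/cvgrPdist_lt => e e0.
have := df e e0; rewrite !near_withinE.
move=> /nbhs_ballP[d /= d0 hd].
have /nbhs_ballP[d' /= d'0 hd'] := near_in_itvoo t11.
apply: filterS2 (nbhs0_lt d0) (nbhs0_lt d'0) => h hd1 hd2 h0.
rewrite /= [h *: _]mulr1 -phiB.
have -> : h = h + t - t by rewrite addrK.
rewrite subrK [_ *: _]mulrC mulrC -phiZ -phiB; apply: le_lt_trans (phi1 _) _.
have dist : `|t - (h + t)| = `|h| by rewrite opprD addrCA subrr addr0 normrN.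
apply: hd.
- by rewrite /ball /= dist.
- by rewrite -subr_eq0 addrK.
- apply: subset_itv_oo_cc; apply: hd'.
  by rewrite /ball /= dist.
Qed.

(** The mean value theorem fails for complex values, so it is applied to the real
    and imaginary parts. *)
Lemma entry_constant f :
  (forall t, t \in `[-1, 1] -> entry_derivI f t 0) ->
  forall t, t \in `[-1, 1] -> f t = f (-1).
Proof.
move=> df t t11.
have real_part (phi : R[i] -> R) : (forall z w, phi (z - w) = phi z - phi w) ->
    (forall (x : R) z, phi (x%:C * z) = x * phi z) ->
    (forall z, `|phi z| <= normc z) -> phi (f t) = phi (f (-1)).
  move=> phiB phiZ phi1.
  have phi0 : phi 0 = 0 by rewrite -(subrr 0) phiB subrr.
  have m1t : -1 <= t by move: t11; rewrite in_itv /= => /andP[].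
  have sub u : u \in `[-1, t] -> u \in `[-1, 1].
    apply: subitvPr; rewrite bnd_simp.
    by move: t11; rewrite in_itv /= => /andP[].
  have cont : {within `[-1, t], continuous (phi \o f)}.
    apply: (continuous_subspaceW (fun u => @sub u)).
    apply: within_continuous_lipschitz => [z w|u u11].
      by rewrite -phiB.
    by exists 0; apply: df.
  have [|c _] := @MVT_segment R (phi \o f) (fun=> 0) (-1) t m1t _ cont.
    move=> u; rewrite in_itv /= => /andP[u1 ut]; rewrite -phi0.
    have u11 : u \in `]-1, 1[.
      rewrite in_itv /= u1 /=; apply: lt_le_trans ut _.
      by move: t11; rewrite in_itv /= => /andP[].
    apply: is_derive_linear => //; apply: df.
    by apply: subset_itv_oo_cc.
  by rewrite mul0r => /eqP; rewrite subr_eq0 => /eqP.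
apply/eqP; rewrite eq_complex; apply/andP; split; apply/eqP.
- apply: (real_part (@complex.Re R)) => [[a b] [a' b']|x [a b]|[a b]] //=.
    by rewrite mul0r subr0.
  by rewrite -sqrtr_sqr ler_wsqrtr // lerDl sqr_ge0.
- apply: (real_part (@complex.Im R)) => [[a b] [a' b']|x [a b]|[a b]] //=.
    by rewrite mul0r addr0.
  by rewrite -sqrtr_sqr ler_wsqrtr // lerDr sqr_ge0.
Qed.

Lemma evalmx_bounded m n (P : 'M[{poly R[i]}]_(m, n)) i j :
  exists c, forall t, t \in `[-1, 1] -> normc (evalmx P t i j) <= c.
Proof.
exists (\sum_(k < size (P i j)) normc (P i j)`_k) => t t11.
rewrite mxE horner_coef; apply: le_trans (normc_sum _ _) _.
apply: ler_sum => k _; rewrite Normc.normcM -rmorphXn normc_real.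
rewrite ler_piMr ?normc_ge0 // normrX exprn_ile1 //.
by rewrite ler_norml; move: t11; rewrite in_itv.
Qed.

Lemma entrywise_boundedB m n (F G : R -> 'M[R[i]]_(m, n)) i j :
  (exists c, forall t, t \in `[-1, 1] -> normc (F t i j) <= c) ->
  (exists c, forall t, t \in `[-1, 1] -> normc (G t i j) <= c) ->
  exists c, forall t, t \in `[-1, 1] -> normc ((F t - G t) i j) <= c.
Proof.
move=> [c hc] [b hb]; exists (c + b) => t t11; rewrite !mxE.
apply: le_trans (normcD _ _) _; apply: lerD; first exact: hc.
by rewrite -[- _]sub0r normcB subr0 hb.
Qed.

Lemma vnorm_bounded n (v : R -> 'cV[R[i]]_n) :
  (forall i, exists c, forall t, t \in `[-1, 1] -> normc (v t i 0) <= c) ->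
  exists c, forall t, t \in `[-1, 1] -> vnorm (v t) <= c.
Proof.
move=> /choice[c hc]; exists (\sum_i c i) => t t11.
by apply: le_trans (vnorm_le_sum _) _; apply: ler_sum => i _; apply: hc.
Qed.

Lemma opnorm_bounded n (M : R -> 'M[R[i]]_n) :
  (forall i j, exists c, forall t, t \in `[-1, 1] -> normc (M t i j) <= c) ->
  exists c, forall t, t \in `[-1, 1] -> opnorm (M t) <= c.
Proof.
move=> Mb.
have col_bounded s : exists c, forall t, t \in `[-1, 1] -> vnorm (col s (M t)) <= c.
  apply: vnorm_bounded => i; have [c hc] := Mb i s.
  by exists c => t t11; rewrite mxE hc.
have [c hc] := choice col_bounded.
exists (Num.sqrt (\sum_s c s ^+ 2)) => t t11.
apply: le_trans (opnorm_le_cols _) _; apply: ler_wsqrtr; apply: ler_sum => s _.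
rewrite lerXn2r ?nnegrE ?vnorm_ge0 ?hc //.
by rewrite (le_trans _ (hc s t t11)) ?vnorm_ge0.
Qed.

End Calculus.

(** * Fundamental solutions *)

Section Solutions.
Set Implicit Arguments.
Unset Strict Implicit.
Variable R : realType.


(** The entrywise reading of [is_solution]; it lets columns solved separately be
    assembled into a matrix without rebuilding a limit of matrices. *)
Definition entry_solution d k (M : R -> 'M[R[i]]_d) (Y0 : 'M[R[i]]_(d, k))
    (Y : R -> 'M[R[i]]_(d, k)) : Prop :=
  Y (-1) = Y0 /\
  forall t, t \in `[-1, 1] ->
    forall i j, entry_derivI (fun u => Y u i j) t ((M t *m Y t) i j).

Lemma is_solution_entry d k (M : R -> 'M[R[i]]_d) (Y0 : 'M[R[i]]_(d, k)) Y :
  is_solution M Y0 Y -> entry_solution M Y0 Y.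
Proof.
move=> [Y0E dY]; split=> // t t11 i j.
exact: (has_derivI_entry (dY t t11)).
Qed.

Lemma of_cols_solution d k (M : R -> 'M[R[i]]_d) (Y0 : 'M[R[i]]_(d, k))
    (y : 'I_k -> R -> 'cV[R[i]]_d) :
  (forall s, is_solution M (col s Y0) (y s)) ->
  entry_solution M Y0 (fun t => of_cols (fun s => y s t)).
Proof.
move=> hy; split=> [|t t11 i s].
  by apply/matrixP => i s; rewrite mxE (hy s).1 mxE.
have : entry_derivI (fun u => y s u i 0) t ((M t *m y s t) i 0).
  exact: (has_derivI_entry ((hy s).2 t t11)).
have -> : (fun u => y s u i 0) = (fun u => of_cols (fun s => y s u) i s).
  by apply/funext => u; rewrite mxE.
congr (entry_derivI _ _ _); rewrite !mxE; apply: eq_bigr => r _.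
by rewrite mxE.
Qed.

(** The entries of Psi^T Phi have derivative
    (- A^T Psi)^T Phi + Psi^T A Phi = 0, so the product stays at its initial
    value. *)
Lemma adjoint_solution_inverse d (A Phi Psi : R -> 'M[R[i]]_d) :
  entry_solution A 1%:M Phi -> entry_solution (fun t => - (A t)^T) 1%:M Psi ->
  forall t, t \in `[-1, 1] -> (Psi t)^T *m Phi t = 1%:M.
Proof.
move=> [Phi0 dPhi] [Psi0 dPsi] t t11.
have -> : 1%:M = (Psi (-1))^T *m Phi (-1) by rewrite Psi0 Phi0 trmx1 mulmx1.
apply/matrixP => i j.
have dotE u : ((Psi u)^T *m Phi u) i j = \sum_k Psi u k i * Phi u k j.
  by rewrite mxE; apply: eq_bigr => k _; rewrite mxE.
rewrite !dotE.
apply: (entry_constant (f := fun u => \sum_k Psi u k i * Phi u k j)) => // u u11.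
have dsum k := entry_derivIM (dPsi u u11 k i) (dPhi u u11 k j).
have := entry_derivI_sum (r := index_enum 'I_d) dsum.
have -> // : \sum_k ((- (A u)^T *m Psi u) k i * Phi u k j +
                  Psi u k i * (A u *m Phi u) k j) = 0.
rewrite big_split /=.
transitivity (((- (A u)^T *m Psi u)^T *m Phi u +
               (Psi u)^T *m (A u *m Phi u)) i j).
  by rewrite [RHS]mxE; congr (_ + _); rewrite [RHS]mxE; apply: eq_bigr => k _;
    congr (_ * _); rewrite [RHS]mxE.
by rewrite mulNmx linearN /= trmx_mul trmxK mulNmx mulmxA addNr mxE.
Qed.

End Solutions.

Theorem lemma19 (R : realType) (N d : nat) (A : R -> 'M[R[i]]_d)
  (y : 'I_d -> R -> 'cV[R[i]]_d) (p : 'I_d -> 'cV[{poly R[i]}]_d)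
  (nu : 'I_d -> R)
  (hN : (1 <= N)%N)
  (hA : {within `[-1, 1], continuous A})
  (hy : forall s : 'I_d, is_solution A (delta_mx s 0) (y s))
  (hp : forall s : 'I_d, is_collocation N A (delta_mx s 0) (p s))
  (hnu : forall s : 'I_d,
    supI (fun t => vnorm (y s t - evalmx (p s) t)) <= nu s) :
  let PhiA (t : R) := of_cols (fun s => y s t) in
  let PhiN (t : R) := of_cols (fun s => evalmx (p s) t) in
  let xi := Num.sqrt (\sum_(s < d) nu s ^+ 2) in
  (forall t : R, t \in `[-1, 1] -> opnorm (PhiA t - PhiN t) <= xi) /\
  (forall (PsiA : R -> 'M[R[i]]_d) (PsiN : 'M[{poly R[i]}]_d) (omega : R),
    is_solution (fun t => - (A t)^T) 1%:M PsiA ->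
    is_collocation_mx N (fun t => - (A t)^T) 1%:M PsiN ->
    (forall t : R, t \in `[-1, 1] ->
      opnorm (PsiA t - evalmx PsiN t) <= omega) ->
    forall s t : R, s \in `[-1, 1] -> t \in `[-1, 1] ->
      opnorm (PhiA t *m invmx (PhiA s)) <=
        (xi + supI (fun u => opnorm (PhiN u))) *
        (omega + supI (fun u => opnorm (evalmx PsiN u)))).
Proof.
move=> PhiA PhiN xi.
have err_bounded s : exists c, forall t, t \in `[-1, 1] ->
    vnorm (y s t - evalmx (p s) t) <= c.
  apply: vnorm_bounded => i; apply: entrywise_boundedB.
    apply: entry_bounded => t t11.
    by exists ((A t *m y s t) i 0); exact: (has_derivI_entry ((hy s).2 t t11)).
  exact: evalmx_bounded.
have col_err s t : t \in `[-1, 1] -> vnorm (y s t - evalmx (p s) t) <= nu s.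
  move=> t11; have [c hc] := err_bounded s.
  exact: le_trans (le_supI hc t11) (hnu s).
have PhiA_near t : t \in `[-1, 1] -> opnorm (PhiA t - PhiN t) <= xi.
  move=> t11; apply: le_trans (opnorm_le_cols _) _.
  apply: ler_wsqrtr; apply: ler_sum => s _.
  have -> : col s (PhiA t - PhiN t) = y s t - evalmx (p s) t.
    by apply/matrixP => i j; rewrite !mxE (ord1 j).
  rewrite lerXn2r ?nnegrE ?vnorm_ge0 ?col_err //.
  by rewrite (le_trans _ (col_err s t t11)) ?vnorm_ge0.
split=> // PsiA PsiN omega hPsi _ PsiA_near s t s11 t11.
have opnorm_approx (Y Z : R -> 'M[R[i]]_d) (c : R) u :
    opnorm (Y u - Z u) <= c ->
    (forall i j, exists b, forall v, v \in `[-1, 1] -> normc (Z v i j) <= b) ->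
    u \in `[-1, 1] -> opnorm (Y u) <= c + supI (fun v => opnorm (Z v)).
  move=> YZ Zb u11; have [b hb] := opnorm_bounded Zb.
  rewrite -[Y u](subrK (Z u)); apply: le_trans (opnormD _ _) _.
  by apply: lerD => //; apply: (le_supI (g := fun v => opnorm (Z v)) hb).
have inverse : (PsiA s)^T *m PhiA s = 1%:M.
  apply: (adjoint_solution_inverse _ (is_solution_entry hPsi) s11).
  apply: of_cols_solution => r.
  have -> : col r 1%:M = delta_mx r 0 :> 'cV[R[i]]_d.
    by apply/matrixP => i j; rewrite !mxE (ord1 j) eqxx andbT.
  exact: hy.
have /= [_ PhiA_unit] := mulmx1_unit inverse.
rewrite -[invmx _]mul1mx -inverse -mulmxA mulmxV // mulmx1.
apply: le_trans (opnormM _ _) _.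
rewrite opnorm_tr; apply: ler_pM; rewrite ?opnorm_ge0 //.
- apply: (opnorm_approx PhiA PhiN) => //; first exact: PhiA_near.
  move=> i j; have [b hb] := evalmx_bounded (p j) i 0.
  by exists b => v v11; rewrite mxE hb.
- apply: (opnorm_approx PsiA (evalmx PsiN)) => //; first exact: PsiA_near.
  exact: evalmx_bounded.
Qed.
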